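(* Let $n\ge1$ and work in $\mathfrak{gl}(n)$ with the notation of the context. (i) The elements $e_{kl}=(\mathrm{ad}\,Y)^{k-l}(X^k)$, $0\le k\le n-1$, $-k\le l\le k$, form a basis of $\mathfrak{gl}(n)$, and $\langle e_{kl},e_{k'l'}\rangle=0$ unless $k=k'$ and $l+l'=0$. (ii) For each fixed $l$ with $0\le l\le n-1$, the polynomials $f_{kl}$, $l\le k\le n-1$, form an orthogonal basis (of the space of functions on $\{\alpha_{l+1},\dots,\alpha_n\}$, equivalently of polynomials of degree $<n-l$) with respect to the bilinear form $$\langle f,g\rangle_l=\sum_{i=l+1}^n f(\alpha_i)g(\alpha_i)T_1(\alpha_i)\cdots T_l(\alpha_i)$$ (for $l=0$ the product of $T$'s is $1$ and the sum is over $i=1,\dots,n$). (iii) For $0\le l\le k\le n-1$, up to a nonzero constant factor $f_{kl}(H)$ coincides with $${}_3F_2\left(\begin{matrix}l-k,\ l+k+1,\ \tfrac12(1-n-H)\\ l+1,\ l+1-n\end{matrix}\ \Big|\ 1\right).$$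
   Context: $\mathfrak{gl}(n)$ carries the form $\langle A,B\rangle=\mathrm{tr}(AB)$. Use the principal embedding of $\mathfrak{sl}(2)$: $Y=\sum_{i=1}^{n-1}E_{i+1,i}$, $H=\sum_{i=1}^n(n-2i+1)E_{ii}$, $X=\sum_{i=1}^{n-1}i(n-i)E_{i,i+1}$ (so $[X,Y]=H$, $[H,X]=2X$, $[H,Y]=-2Y$). Set $\alpha_i=n-2i+1$ and $T_i(H)=\frac14(n^2-(H+2i-1)^2)$. For a polynomial $f$, $f(H)=\mathrm{diag}(f(\alpha_1),\dots,f(\alpha_n))$. For $0\le l\le k\le n-1$, the polynomials $f_{kl}$ and $f_{k,-l}$ are the unique polynomials of degree $<n-l$ with $(\mathrm{ad}\,Y)^{k-l}(X^k)=X^lf_{kl}(H)$ and $(\mathrm{ad}\,Y)^{k+l}(X^k)=f_{k,-l}(H)Y^l$. The generalized hypergeometric function is ${}_3F_2\left(\begin{matrix}a_1,a_2,a_3\\ b_1,b_2\end{matrix}\,\big|\,z\right)=\sum_{i\ge0}\frac{(a_1)_i(a_2)_i(a_3)_i}{(b_1)_i(b_2)_i}\frac{z^i}{i!}$ with $(a)_0=1$, $(a)_i=a(a+1)\cdots(a+i-1)$. *)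

(* Defs.v *)
From HB Require Import structures.
From mathcomp Require Import all_boot all_order all_algebra.
Set Implicit Arguments. Unset Strict Implicit. Unset Printing Implicit Defensive.
Import Order.TTheory GRing.Theory Num.Theory.
Local Open Scope ring_scope.

Section Defs.
Variable R : numFieldType.
Variable n : nat.

(* Indices below are 0-based: row/column r : 'I_n corresponds to r+1. *)

Definition Ymx : 'M[R]_n := \matrix_(r, c) ((r == c.+1 :> nat)%:R).

(* alpha_i = n - 2 i + 1 (i is 1-based) *)
Definition alpha (i : nat) : R := n%:R - 2 * i%:R + 1.

Definition diagfun (g : R -> R) : 'M[R]_n :=
  \matrix_(r, c) ((r == c :> nat)%:R * g (alpha r.+1)).

Definition polyH (f : {poly R}) : 'M[R]_n := diagfun (fun x => f.[x]).

Definition Hmx : 'M[R]_n := diagfun id.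

Definition Xmx : 'M[R]_n :=
  \matrix_(r, c) ((c == r.+1 :> nat)%:R * ((r.+1 * (n - r.+1))%N)%:R).

(* matrix powers (for arbitrary n, 'M_n is not canonically a ring) *)
Definition mxpow (A : 'M[R]_n) (k : nat) : 'M[R]_n := iter k (mulmx A) 1%:M.

Definition adY (A : 'M[R]_n) : 'M[R]_n := Ymx *m A - A *m Ymx.

Definition e_kl (k : nat) (l : int) : 'M[R]_n :=
  iter `|k%:Z - l|%N adY (mxpow Xmx k).

Definition trform (A B : 'M[R]_n) : R := \tr (A *m B).

Definition Tfun (i : nat) (x : R) : R :=
  (n%:R ^+ 2 - (x + 2 * i%:R - 1) ^+ 2) / 4.

Definition formL (l : nat) (f g : {poly R}) : R :=
  \sum_(l.+1 <= i < n.+1)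
     f.[alpha i] * g.[alpha i] * \prod_(1 <= j < l.+1) Tfun j (alpha i).

End Defs.

Definition poch (R : numFieldType) (a : R) (i : nat) : R :=
  \prod_(j < i) (a + j%:R).

(* Partial sum (terms i = 0..N) of the generalized hypergeometric series
   3F2(a1,a2,a3; b1,b2 | z) = sum_i (a1)_i (a2)_i (a3)_i / ((b1)_i (b2)_i) z^i / i!.
   When a1 is a nonpositive integer -N the series terminates and this
   partial sum is its exact value. *)
Definition hyp3F2 (R : numFieldType) (a1 a2 a3 b1 b2 z : R) (N : nat) : R :=
  \sum_(i < N.+1)
    poch a1 i * poch a2 i * poch a3 i / (poch b1 i * poch b2 i)
      * z ^+ i / (i`!)%:R.

(* Main.v *)
Require Import Defs.
From HB Require Import structures.
From mathcomp Require Import all_boot all_order all_algebra.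
From mathcomp Require Import ring zify.
Import Order.TTheory GRing.Theory Num.Theory.
Local Open Scope ring_scope.

(** In coordinates, [ad Y] sends the
    function [m] on one diagonal to the difference [m(r-1) - m(r)] on the next
    one. Writing the entries of [(ad Y)^(k-l) X^k] as (entry of [X^l]) times
    [h_kl], and those of [(ad Y)^(k+l) X^k] as multiples of [h_kl], this
    becomes a lowering relation from [h_(k,l+1)] to [h_kl] above the main
    diagonal and a difference relation from [h_kl] to [h_(k,l+1)] below it.
    Both are satisfied by the terminating 3F2 (a Hahn polynomial), as one sees
    by comparing coefficients of the shifted factorials [(-x)_i]. Hence
    [(ad Y)^(2k+1) X^k = 0], and the invariance of the trace form under [ad Y]
    gives the orthogonality of the [e_kl]; it also gives that of the [f_kl],
    since [f_kl] and [f_(k,-l)] are proportional. *)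

(** * Shifted factorials *)

Section Pochhammer.
Variable R : numFieldType.
Implicit Types (a x : R) (i : nat).

Lemma poch0 a : poch a 0 = 1.
Proof. by rewrite /poch big_ord0. Qed.

Lemma pochS a i : poch a i.+1 = poch a i * (a + i%:R).
Proof. by rewrite /poch big_ord_recr. Qed.

Lemma pochSl a i : poch a i.+1 = a * poch (a + 1) i.
Proof.
rewrite /poch big_ord_recl addr0; congr (_ * _).
by apply: eq_bigr => j _; rewrite /= /bump /= add1n -natr1; ring.
Qed.

Lemma poch_opp_nat_eq0 (m i : nat) : (m < i)%N -> poch (- m%:R : R) i = 0.
Proof.
move=> mi; rewrite /poch (bigD1 (Ordinal mi)) //= addrC subrr.
by rewrite mul0r.
Qed.

(** The analogue of differentiating a power: both factorials contain $(-x)_i$, and the remaining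
    factors $-(x+1)$ and $-x+i$ differ by $-(i+1)$. *)
Lemma poch_opp_diff x i :
  poch (- (x + 1)) i.+1 - poch (- x) i.+1 = - i.+1%:R * poch (- x) i.
Proof.
have e : - (x + 1) + 1 = - x by ring.
by rewrite pochSl e pochS -natr1; ring.
Qed.

End Pochhammer.

(** * Hahn polynomials: coefficient recurrences, lowering and difference relations *)

Section Hahn.
Variable R : numFieldType.
Variable n : nat.

Definition hahn_coef (k l i : nat) : R :=
  poch (l%:R - k%:R) i * poch (l + k + 1)%:R i
  / (poch (l + 1)%:R i * poch (l%:R + 1 - n%:R) i) / (i`!)%:R.

(* The Hahn polynomial of degree k - l; the node alpha_i corresponds to
   x = n - i. *)
Definition hahn (k l : nat) (x : R) : R :=
  \sum_(i < (k - l).+1) hahn_coef k l i * poch (- x) i.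

Lemma hahnE k l x :
  hyp3F2 (l%:R - k%:R) (l + k + 1)%:R (- x) (l + 1)%:R (l%:R + 1 - n%:R) 1
    (k - l) = hahn k l x.
Proof.
apply: eq_bigr => i _; rewrite expr1n mulr1 /hahn_coef -!mulrA.
by do 2 congr (_ * _); rewrite mulrC -!mulrA; congr (_ * _); rewrite mulrC.
Qed.

Lemma hahn_coef0 k l : hahn_coef k l 0 = 1.
Proof. by rewrite /hahn_coef !poch0 !mulr1 fact0 !divr1. Qed.

Lemma hahn_coef_eq0 k l i : (l <= k)%N -> (k - l < i)%N -> hahn_coef k l i = 0.
Proof.
move=> lk kli; rewrite /hahn_coef -opprB -natrB // poch_opp_nat_eq0 //.
by rewrite !mul0r.
Qed.

Lemma natr_sub_neq0 (i : nat) : (i < n)%N -> i%:R - n%:R != 0 :> R.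
Proof. by move=> ltin; rewrite subr_eq0 eqr_nat neq_ltn ltin. Qed.

Lemma hahn_coefS k l i : (l <= k < n)%N ->
  (l + i + 1)%:R * ((l + i + 1)%:R - n%:R) * i.+1%:R * hahn_coef k l i.+1
  = ((l + i)%:R - k%:R) * (l + k + i + 1)%:R * hahn_coef k l i.
Proof.
move=> /andP[lk kn]; have [ltki|leik] := ltnP (k - l) i.
  by rewrite !hahn_coef_eq0 ?mulr0 // ltnW.
(* At $i=k-l$ the denominator factor $l+i+1-n$ vanishes when $k=n-1$, so nothing is divided: both
   sides are zero. *)
have [eik|neik] := eqVneq i (k - l)%N.
  rewrite hahn_coef_eq0 //; last by rewrite eik.
  by rewrite eik subnKC // subrr !mul0r mulr0.
have D1 : (l + i + 1)%:R != 0 :> R by rewrite pnatr_eq0 addn1.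
have D2 : (l + i + 1)%:R - n%:R != 0 :> R by apply: natr_sub_neq0; lia.
have D3 : i.+1%:R != 0 :> R by rewrite pnatr_eq0.
have e1 : (l + 1)%:R + i%:R = (l + i + 1)%:R :> R by rewrite !natrD; ring.
have e2 : l%:R + 1 - n%:R + i%:R = (l + i + 1)%:R - n%:R :> R.
  by rewrite !natrD; ring.
rewrite /hahn_coef !pochS factS natrM !invfM e1 e2.
have -> : l%:R - k%:R + i%:R = (l + i)%:R - k%:R :> R by rewrite natrD; ring.
have -> : (l + k + 1)%:R + i%:R = (l + k + i + 1)%:R :> R.
  by rewrite !natrD; ring.
move: ((l + i + 1)%:R : R) ((l + i + 1)%:R - n%:R : R) (i.+1%:R : R) D1 D2 D3.
move=> d1 d2 d3 D1 D2 D3.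
transitivity ((d1 / d1) * (d2 / d2) * (d3 / d3) *
  (((l + i)%:R - k%:R) * (l + k + i + 1)%:R * hahn_coef k l i)).
  by rewrite /hahn_coef !invfM; ring.
by rewrite !divff // !mul1r /hahn_coef !invfM.
Qed.

(** Splitting off first factors, $(a)_{i+1}=a\,(a+1)_i$, raises all four parameters by one, which is
    the passage from $l$ to $l+1$. *)
Lemma hahn_coef_shift k l i : (l < k < n)%N ->
  (l.+1)%:R * (n%:R - l.+1%:R) * i.+1%:R * hahn_coef k l i.+1
  = (k%:R - l%:R) * (l + k + 1)%:R * hahn_coef k l.+1 i.
Proof.
move=> /andP[lk kn].
have D1 : l.+1%:R != 0 :> R by rewrite pnatr_eq0.
have D2 : l.+1%:R - n%:R != 0 :> R by apply: natr_sub_neq0; lia.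
have D3 : i.+1%:R != 0 :> R by rewrite pnatr_eq0.
rewrite /hahn_coef !pochSl factS natrM !invfM.
have -> : l%:R - k%:R + 1 = l.+1%:R - k%:R :> R by rewrite -natr1; ring.
have -> : (l + k + 1)%:R + 1 = (l.+1 + k + 1)%:R :> R by rewrite natr1; congr _%:R; lia.
have -> : (l + 1)%:R + 1 = (l.+1 + 1)%:R :> R by rewrite natr1; congr _%:R; lia.
have -> : l%:R + 1 = l.+1%:R :> R by rewrite natr1.
have -> : l.+1%:R - n%:R + 1 = l.+1%:R + 1 - n%:R :> R by ring.
rewrite !addn1 -(opprB l.+1%:R n%:R).
move: (l.+1%:R : R) (l.+1%:R - n%:R : R) (i.+1%:R : R) D1 D2 D3 => d1 d2 d3 D1 D2 D3.
set a := poch (d1 - _) _; set b := poch _ i; set c := (poch _ i)^-1.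
set d := (poch _ i)^-1.
transitivity ((d1 / d1) * (d2 / d2) * (d3 / d3) *
   ((k%:R - l%:R) * (l + k).+1%:R * (a * b * (c * d) / i`!%:R))).
  by ring.
by rewrite !divff // !mul1r.
Qed.

Lemma hahn_widen k l N x : (l <= k)%N -> (k - l < N)%N ->
  hahn k l x = \sum_(i < N) hahn_coef k l i * poch (- x) i.
Proof.
move=> lk kN; rewrite /hahn (big_ord_widen N (fun i => hahn_coef k l i * poch (- x) i)) //.
rewrite big_mkcond; apply: eq_bigr => i _; case: ifP => // /negbT.
by rewrite -leqNgt => ki; rewrite hahn_coef_eq0 // mul0r.
Qed.

Lemma hahn_id k x : hahn k k x = 1.
Proof. by rewrite /hahn subnn big_ord1 hahn_coef0 poch0 mulr1. Qed.

(* Both sides are expanded in the basis of the (-x)_i, where the right-hand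
   side has only the contributions of hahn_coef k l.+1 i to degrees i and
   i + 1. *)
Lemma hahn_lower k l x : (l < k < n)%N ->
  l.+1%:R * (n%:R - l.+1%:R) * hahn k l x =
  (n%:R - x - l.+1%:R) * (x + l.+1%:R) * hahn k l.+1 x
  - x * (n%:R - x) * hahn k l.+1 (x - 1).
Proof.
move=> lkn; have /andP[lk kn] := lkn.
pose N := (k - l)%N.
rewrite (hahn_widen k l N.+1) ?(ltnW lk) // !(hahn_widen k l.+1 N.+1) //; try lia.
(* The terms quadratic in $x$ cancel on the right, so its $i$-th summand is
   $u_i(-x)_i+v_i(-x)_{i+1}$. *)
pose u (i : nat) := (i + l.+1)%:R * (n%:R - l.+1%:R - i%:R) * hahn_coef k l.+1 i.
pose v (i : nat) := (i + 2 * l.+1)%:R * hahn_coef k l.+1 i.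
transitivity (\sum_(i < N.+1) u i * poch (- x) i
              + \sum_(i < N.+1) v i * poch (- x) i.+1); last first.
  rewrite !mulr_sumr -sumrB -big_split /=; apply: eq_bigr => i _.
  have e : x * poch (- (x - 1)) i = - poch (- x) i.+1.
    by rewrite pochSl opprB [1 - x]addrC; ring.
  rewrite [RHS](_ : _ = (n%:R - x - l.+1%:R) * (x + l.+1%:R)
     * (hahn_coef k l.+1 i * poch (- x) i)
     - (n%:R - x) * hahn_coef k l.+1 i * (x * poch (- (x - 1)) i)); last by ring.
  by rewrite e pochS /u /v !natrD natrM; ring.
rewrite [in X in _ = _ + X]big_ord_recr /= /v hahn_coef_eq0 ?mulr0 ?mul0r ?addr0; try lia.
rewrite mulr_sumr !big_ord_recl /= poch0 -addrA -big_split /= /u !hahn_coef0.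
congr (_ + _); first by rewrite add0n !mulr1 subr0.
apply: eq_bigr => i _; rewrite /bump /= add1n.
rewrite [LHS]mulrA -[RHS]mulrDl; congr (_ * _).
(* The factor $i+1$ lets [hahn_coef_shift] rewrite the left side and [hahn_coefS], at $l+1$, remove
   the coefficient of index $i+1$ on the right. *)
have D3 : i.+1%:R != 0 :> R by rewrite pnatr_eq0.
apply: (mulfI D3).
rewrite mulrA [i.+1%:R * _]mulrC hahn_coef_shift //.
have := hahn_coefS k l.+1 i; rewrite kn lk => /(_ isT) H.
transitivity (- ((l.+1 + i + 1)%:R * ((l.+1 + i + 1)%:R - n%:R) * i.+1%:R * hahn_coef k l.+1 i.+1)
   + i.+1%:R * (i + 2 * l.+1)%:R * hahn_coef k l.+1 i).
  by rewrite H !natrD natrM -!natr1; ring.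
by rewrite !natrD natrM -!natr1; ring.
Qed.

(** Termwise: the difference lowers $(-x)_{i+1}$ to $(-x)_i$, and [hahn_coef_shift] identifies the
    new coefficients. *)
Lemma hahn_diff k l x : (l < k < n)%N ->
  l.+1%:R * (n%:R - l.+1%:R) * (hahn k l (x + 1) - hahn k l x)
  = - ((k%:R - l%:R) * (l + k + 1)%:R) * hahn k l.+1 x.
Proof.
move=> lkn; have /andP[lk kn] := lkn.
pose N := (k - l)%N.
rewrite !(hahn_widen k l N.+1) ?(ltnW lk) // (hahn_widen k l.+1 N) //; try lia.
rewrite -sumrB big_ord_recl !poch0 subrr add0r !mulr_sumr.
apply: eq_bigr => i _; rewrite /= /bump /= add1n -mulrBr poch_opp_diff.
transitivity (- (l.+1%:R * (n%:R - l.+1%:R) * i.+1%:R * hahn_coef k l i.+1)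
  * poch (- x) i); first by ring.
by rewrite hahn_coef_shift //; ring.
Qed.

End Hahn.

(** * Matrix entries of the iterates of $\mathrm{ad}\,Y$ on $X^k$ *)

Section AdY.
Variable R : numFieldType.
Variable n : nat.
Local Notation X := (Xmx R n).

(** Left and right multiplication by $Y$ shift rows and columns. Indexing [F] by naturals gives
    meaning to $r-1$ and $c+1$; the zeros stand for neighbours outside the matrix. *)
Lemma adY_entry (A : 'M[R]_n) (F : nat -> nat -> R) :
  (forall r c : 'I_n, A r c = F r c) ->
  forall r c : 'I_n, adY A r c =
    (if (0 < r)%N then F r.-1 c else 0) - (if (c.+1 < n)%N then F r c.+1 else 0).
Proof.
move=> AF r c; rewrite !mxE; congr (_ - _).
  case: ifP => r0.
    have ltr : (r.-1 < n)%N by apply: leq_ltn_trans (leq_pred r) (ltn_ord r).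
    rewrite (bigD1 (Ordinal ltr)) //= mxE AF /= prednK // eqxx mul1r.
    rewrite big1 ?addr0 // => j; rewrite -val_eqE /= mxE => nj.
    by rewrite (_ : (_ == _) = false) ?mul0r //; lia.
  rewrite big1 // => j _; rewrite mxE.
  by rewrite (_ : (_ == _) = false) ?mul0r //; lia.
case: ifP => cn.
  rewrite (bigD1 (Ordinal cn)) //= mxE AF /= eqxx mulr1.
  rewrite big1 ?addr0 // => j; rewrite -val_eqE /= mxE => nj.
  by rewrite (_ : (_ == _) = false) ?mulr0 //; lia.
rewrite big1 // => j _; rewrite mxE.
have := ltn_ord j => jn.
by rewrite (_ : (_ == _) = false) ?mulr0 //; lia.
Qed.

(** The entry of $X^l$ in row $r$ and column $r+l$, counted from 0. For $l>0$ the truncated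
    subtraction makes it vanish once $r+l\ge n$. *)
Definition Xweight (l r : nat) : R :=
  \prod_(j < l) ((r + j.+1) * (n - (r + j.+1)))%:R.

Lemma Xweight0 r : Xweight 0 r = 1.
Proof. by rewrite /Xweight big_ord0. Qed.

Lemma XweightS l r :
  Xweight l.+1 r = Xweight l r * ((r + l.+1) * (n - (r + l.+1)))%:R.
Proof. by rewrite /Xweight big_ord_recr. Qed.

Lemma XweightSl l r :
  Xweight l.+1 r = (r.+1 * (n - r.+1))%:R * Xweight l r.+1.
Proof.
rewrite /Xweight big_ord_recl /= addn1; congr (_ * _).
by apply: eq_bigr => j _; rewrite /= /bump /= add1n addnS addSn.
Qed.

Lemma Xweight_gt0 l r : (r + l < n)%N -> 0 < Xweight l r.
Proof.
move=> rln; apply: prodr_gt0 => j _; rewrite ltr0n muln_gt0.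
by have := ltn_ord j; lia.
Qed.

Lemma mxpowX_entry l (r c : 'I_n) :
  mxpow X l r c = (c == r + l :> nat)%N%:R * Xweight l r.
Proof.
elim: l r c => [|l IHl] r c.
  by rewrite /mxpow /= mxE Xweight0 mulr1 addn0 -val_eqE eq_sym.
rewrite /mxpow /= -/(mxpow X l) mxE XweightSl.
have [rn|nr] := ltnP r.+1 n.
  rewrite (bigD1 (Ordinal rn)) //= mxE IHl /= eqxx mul1r addnS addSn.
  rewrite big1 ?addr0 => [|j]; first by rewrite mulrCA.
  rewrite -val_eqE /= mxE => nj.
  by rewrite (_ : (_ == _) = false) ?mul0r //; lia.
rewrite (_ : n - r.+1 = 0)%N; last by lia.
rewrite muln0 mul0r mulr0 big1 // => j _; rewrite mxE.
have := ltn_ord j => jn.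
by rewrite (_ : (_ == _) = false) ?mul0r //; lia.
Qed.

(** Each step passes from $l+1$ to $l=k-m-1$ by [hahn_lower] at $x=n-1-c$, where its two
    coefficients become $r(n-r)$ and $(c+1)(n-c-1)$. These vanish exactly where a neighbour is
    missing. *)
Lemma adY_pow_upper k m : (k < n)%N -> (m <= k)%N ->
  exists2 C : R, C != 0 & forall r c : 'I_n,
    iter m (@adY R n) (mxpow X k) r c =
    (c == r + (k - m) :> nat)%N%:R
      * (C * Xweight (k - m) r * hahn R n k (k - m) (n%:R - 1 - c%:R)).
Proof.
move=> kn; elim: m => [_|m IHm mk].
  exists 1; first exact: oner_neq0.
  by move=> r c; rewrite subn0 hahn_id mulr1 mul1r mxpowX_entry.
have [C C0 HC] := IHm (ltnW mk).
pose l := (k - m.+1)%N.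
have El : (k - m = l.+1)%N by rewrite /l; lia.
rewrite El in HC.
exists (C * (l.+1%:R * (n%:R - l.+1%:R))).
  rewrite !mulf_neq0 ?pnatr_eq0 // subr_eq0 eqr_nat; lia.
move=> r c; rewrite iterS.
rewrite (@adY_entry _ (fun r c => (c == r + l.+1 :> nat)%N%:R
      * (C * Xweight l.+1 r * hahn R n k l.+1 (n%:R - 1 - c%:R)))) // -/l.
have [Ec|Nc] := eqVneq (c : nat) (r + l)%N; last first.
  rewrite mul0r.
  have -> : (c.+1 == r + l.+1)%N = false by lia.
  case: ifP => r0; last by rewrite mul0r if_same subr0.
  have -> : (c == r.-1 + l.+1 :> nat)%N = false by lia.
  by rewrite !mul0r if_same subr0.
rewrite mul1r.
have -> : (if (0 < r)%N then (c == r.-1 + l.+1 :> nat)%N%:R *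
     (C * Xweight l.+1 r.-1 * hahn R n k l.+1 (n%:R - 1 - c%:R)) else 0)
   = C * Xweight l r * (r%:R * (n%:R - r%:R)) * hahn R n k l.+1 (n%:R - 1 - c%:R).
  case: (posnP r) => [->|r0]; first by rewrite mul0r mulr0 mul0r.
  have -> : (c == r.-1 + l.+1 :> nat)%N by lia.
  rewrite mul1r XweightSl prednK // natrM natrB; last by apply: ltnW.
  ring.
have -> : (if (c.+1 < n)%N then (c.+1 == r + l.+1)%N%:R *
     (C * Xweight l.+1 r * hahn R n k l.+1 (n%:R - 1 - c.+1%:R)) else 0)
   = C * Xweight l r * (c.+1%:R * (n%:R - c.+1%:R)) * hahn R n k l.+1 (n%:R - 1 - c%:R - 1).
  have -> : (c.+1 == r + l.+1)%N by lia.
  case: (ltnP c.+1 n) => cn; last first.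
    have -> : c.+1 = n by have := ltn_ord c; lia.
    by rewrite subrr mulr0 mulr0 mul0r.
  have -> : n%:R - 1 - c%:R - 1 = n%:R - 1 - c.+1%:R :> R by rewrite -natr1; ring.
  rewrite XweightS (_ : r + l.+1 = c.+1)%N; last by lia.
  by rewrite mul1r natrM natrB ?(ltnW cn) //; ring.
have lkn : (l < k < n)%N by rewrite kn /l; lia.
have := @hahn_lower R n k l (n%:R - 1 - c%:R) lkn.
set h := hahn _ _ _ l _; set h1 := hahn _ _ _ _ _; set h2 := hahn _ _ _ _ _.
move=> H.
have -> : C * (l.+1%:R * (n%:R - l.+1%:R)) * Xweight l r * h
   = C * Xweight l r * (l.+1%:R * (n%:R - l.+1%:R) * h) by ring.
have er : r%:R = c%:R - l%:R :> R by rewrite Ec natrD; ring.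
by rewrite H er -!natr1; ring.
Qed.

(** Starting from the main diagonal, each step is [hahn_diff]: going from row $r$ to $r-1$ replaces
    $x$ by $x+1$. *)
Lemma adY_pow_lower k l : (k < n)%N -> (l <= k)%N ->
  exists2 C : R, C != 0 & forall r c : 'I_n,
    iter (k + l) (@adY R n) (mxpow X k) r c =
    (r == c + l :> nat)%N%:R * (C * hahn R n k l (n%:R - 1 - r%:R)).
Proof.
move=> kn; elim: l => [_|l IHl lk].
  have [C C0 HC] := @adY_pow_upper k k kn (leqnn k).
  exists C => // r c; rewrite addn0 HC subnn Xweight0 mulr1 !addn0 eq_sym.
  by case: eqP => [->|]; rewrite ?mul0r.
have [C C0 HC] := IHl (ltnW lk).
have lkn : (l < k < n)%N by rewrite kn lk.
pose D : R := l.+1%:R * (n%:R - l.+1%:R).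
have D0 : D != 0 by rewrite mulf_neq0 ?pnatr_eq0 // subr_eq0 eqr_nat; lia.
exists (- (C * ((k%:R - l%:R) * (l + k + 1)%:R) / D)).
  rewrite oppr_eq0 !mulf_neq0 ?invr_eq0 ?pnatr_eq0 ?addn1 //.
  by rewrite subr_eq0 eqr_nat; lia.
move=> r c; rewrite addnS iterS.
rewrite (@adY_entry _ (fun r c => (r == c + l :> nat)%N%:R
      * (C * hahn R n k l (n%:R - 1 - r%:R)))) //.
have [Er|Nr] := eqVneq (r : nat) (c + l.+1)%N; last first.
  rewrite mul0r (_ : (r == c.+1 + l :> nat)%N = false); last by lia.
  rewrite mul0r if_same subr0; case: ifP => // r0.
  by rewrite (_ : (_ == _) = false) ?mul0r //; lia.
have rn := ltn_ord r.
have -> : (0 < r)%N by lia.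
have -> : (c.+1 < n)%N by lia.
have -> : (r == c.+1 + l :> nat)%N by lia.
have -> : (r.-1 == c + l :> nat)%N by lia.
rewrite !mul1r.
have -> : n%:R - 1 - r.-1%:R = n%:R - 1 - r%:R + 1 :> R.
  have -> : (r : nat) = r.-1.+1 by lia.
  by rewrite /= -natr1; ring.
rewrite -mulrBr; apply: (mulfI D0).
have := @hahn_diff R n k l (n%:R - 1 - r%:R) lkn; rewrite -/D => H.
rewrite mulrCA H.
set h := hahn _ _ _ _ _.
transitivity ((D / D) * (C * (- ((k%:R - l%:R) * (l + k + 1)%:R) * h))).
  by rewrite divff // mul1r.
by ring.
Qed.

(** After $2k$ steps the entries are constant along their diagonal, and every position on the next
    diagonal has both neighbours inside the matrix. *)
Lemma adY_pow_eq0 k m : (k < n)%N -> (2 * k < m)%N ->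
  iter m (@adY R n) (mxpow X k) = 0.
Proof.
move=> kn km; have -> : (m = (m - (2 * k).+1) + (k + k).+1)%N by lia.
rewrite iterD iterS.
have [C C0 HC] := @adY_pow_lower k k kn (leqnn k).
have -> : adY (iter (k + k) (@adY R n) (mxpow X k)) = 0.
  apply/matrixP => r c; rewrite [RHS]mxE.
  rewrite (@adY_entry _ (fun r c => (r == c + k :> nat)%N%:R * C)); last first.
    by move=> r' c'; rewrite HC hahn_id mulr1.
  have rn := ltn_ord r.
  have [Er|Nr] := eqVneq (r : nat) (c.+1 + k)%N.
    have -> : (0 < r)%N by lia.
    have -> : (c.+1 < n)%N by lia.
    have -> : (r.-1 == c + k)%N by lia.
    by rewrite mul1r subrr.
  rewrite mul0r if_same subr0; case: ifP => // r0.
  by rewrite (_ : (_ == _) = false) ?mul0r //; lia.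
elim: (m - _)%N => //= j ->.
by rewrite /adY mulmx0 mul0mx subrr.
Qed.

Lemma adY_pow_grading k m (r c : 'I_n) : (k < n)%N -> (c + m != r + k)%N ->
  iter m (@adY R n) (mxpow X k) r c = 0.
Proof.
move=> kn cm; have [mk|km] := leqP m k.
  have [C _ ->] := @adY_pow_upper k m kn mk.
  by rewrite (_ : (_ == _) = false) ?mul0r //; lia.
have [m2k|k2m] := leqP m (2 * k); last by rewrite adY_pow_eq0 // mxE.
have mk : (m - k <= k)%N by lia.
have [C _] := @adY_pow_lower k (m - k) kn mk.
rewrite subnKC ?(ltnW km) // => ->.
by rewrite (_ : (_ == _) = false) ?mul0r //; lia.
Qed.

(** * Invariance of the trace form and orthogonality *)

Lemma trformE (A B : 'M[R]_n) : trform A B = \sum_r \sum_c A r c * B c r.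
Proof. by apply: eq_bigr => r _; rewrite mxE. Qed.

Lemma trformC (A B : 'M[R]_n) : trform A B = trform B A.
Proof. exact: mxtrace_mulC. Qed.

Lemma trform_adY (A B : 'M[R]_n) : trform (adY A) B = - trform A (adY B).
Proof.
rewrite /trform /adY mulmxBl mulmxBr !linearB /= opprB; congr (_ - _).
  by rewrite -mulmxA mxtrace_mulC mulmxA.
by rewrite mulmxA.
Qed.

Lemma trform_iter_adY m (A B : 'M[R]_n) :
  trform (iter m (@adY R n) A) B = (-1) ^+ m * trform A (iter m (@adY R n) B).
Proof.
elim: m B => [|m IHm] B; first by rewrite mul1r.
by rewrite iterS trform_adY IHm -iterSr exprS mulN1r mulNr.
Qed.

(** Unless $m+m'=k+k'$ the two supporting diagonals do not pair. Otherwise moving every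
    $\mathrm{ad}\,Y$ onto $X^k$ applies it $k+k'>2k$ times, giving zero. *)
Lemma trform_adY_pow_lt k k' m m' : (k < n)%N -> (k' < n)%N -> (k < k')%N ->
  trform (iter m (@adY R n) (mxpow X k)) (iter m' (@adY R n) (mxpow X k')) = 0.
Proof.
move=> kn kn' kk'.
have [mm|mm] := eqVneq (m + m')%N (k + k')%N; last first.
  rewrite trformE big1 // => r _; rewrite big1 // => c _.
  have [cm|cm] := eqVneq (c + m)%N (r + k)%N; last first.
    by rewrite adY_pow_grading // mul0r.
  by rewrite [X in _ * X]adY_pow_grading ?mulr0 //; lia.
rewrite trformC trform_iter_adY -iterD adY_pow_eq0 //; last by lia.
by rewrite /trform mulmx0 linear0 mulr0.
Qed.

Lemma trform_adY_pow_eq0 k k' m m' : (k < n)%N -> (k' < n)%N ->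
  ~ (k = k' /\ m + m' = 2 * k)%N ->
  trform (iter m (@adY R n) (mxpow X k)) (iter m' (@adY R n) (mxpow X k')) = 0.
Proof.
move=> kn kn' H; case: (ltngtP k k') => kk'.
- exact: trform_adY_pow_lt.
- by rewrite trformC trform_adY_pow_lt.
rewrite -kk' in kn' H *.
rewrite trformE big1 // => r _; rewrite big1 // => c _.
have [cm|cm] := eqVneq (c + m)%N (r + k)%N; last first.
  by rewrite adY_pow_grading // mul0r.
by rewrite [X in _ * X]adY_pow_grading ?mulr0 //; lia.
Qed.

(** Up to sign this pairs $X^k$ with $(\mathrm{ad}\,Y)^{2k}X^k$, a nonzero multiple of $Y^k$, which
    leaves a sum of positive weights. *)
Lemma trform_adY_pow_neq0 k m m' : (k < n)%N -> (m + m' = 2 * k)%N ->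
  trform (iter m (@adY R n) (mxpow X k)) (iter m' (@adY R n) (mxpow X k)) != 0.
Proof.
move=> kn mm; rewrite trformC trform_iter_adY -iterD addnC mm.
rewrite mulf_neq0 ?signr_eq0 // trformE.
have [C C0] := @adY_pow_lower k k kn (leqnn k).
rewrite addnn -mul2n => HC.
rewrite (_ : \sum_r _ =
   C * \sum_(r < n) \sum_(c < n) (c == r + k :> nat)%N%:R * Xweight k r); last first.
  rewrite mulr_sumr; apply: eq_bigr => r _; rewrite mulr_sumr.
  apply: eq_bigr => c _; rewrite HC mxpowX_entry hahn_id mulr1.
  by case: eqP; rewrite ?mul0r ?mulr0 // !mul1r mulrC.
rewrite mulf_neq0 // gt_eqF //.
have n0 : (0 < n)%N by lia.
have ge0 (r c : 'I_n) : 0 <= (c == r + k :> nat)%N%:R * Xweight k r.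
  case: eqP => [e|]; rewrite ?mul0r // mul1r ltW // Xweight_gt0 //.
  by rewrite -e ltn_ord.
rewrite (bigD1 (Ordinal n0)) //= ltr_pwDl //; last first.
  by apply: sumr_ge0 => r _; apply: sumr_ge0.
rewrite (bigD1 (Ordinal kn)) //= ltr_pwDl //; last first.
  by apply: sumr_ge0 => c _; apply: (ge0 (Ordinal n0) c).
by rewrite eqxx mul1r Xweight_gt0.
Qed.

End AdY.

(** If [v i] were in the span of the later vectors, [phi i] would vanish on it, contrary to the last
    hypothesis. *)
Lemma free_map_dual (K : fieldType) (vT : vectType K) (I : eqType) (s : seq I)
    (v : I -> vT) (phi : I -> vT -> K) :
  (forall i a u w, phi i (a *: u + w) = a * phi i u + phi i w) -> uniq s ->
  {in s &, forall i j, i != j -> phi i (v j) = 0} ->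
  {in s, forall i, phi i (v i) != 0} ->
  free [seq v i | i <- s].
Proof.
move=> lin; elim: s => [|i s IHs] /=; first by rewrite nil_free.
case/andP=> is_s us orth nz; rewrite free_cons IHs //; last first.
- by move=> j js; apply: nz; rewrite inE js orbT.
- by move=> j j' js js'; apply: orth; rewrite inE ?js ?js' orbT.
rewrite andbT; apply/negP => vi; have /negP[] := nz i (mem_head _ _).
have phi0 : phi i 0 = 0.
  by have := lin i 1 0 0; rewrite scaler0 addr0 mul1r -[LHS]addr0 => /addrI.
rewrite (@coord_span _ _ _ (in_tuple _) _ vi); apply/eqP.
apply: (big_ind (fun u => phi i u = 0)) => // [u w pu pw|j _].
  by rewrite -[u]scale1r lin pu pw mulr0 addr0.
rewrite -[_ *: _]addr0 lin phi0 addr0.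
have js : (j < size s)%N by rewrite -(size_map v) ltn_ord.
rewrite (nth_map i) // orth ?mulr0 ?mem_head // ?inE ?mem_nth ?orbT //.
by apply: contraNneq is_s => ->; rewrite mem_nth.
Qed.

(** * The bases $e_{kl}$ and $f_{kl}$ *)

Section Basis.
Variable R : numFieldType.
Variable n : nat.
Local Notation X := (Xmx R n).

Lemma e_klE k (l : int) (m : nat) : l = k%:Z - m%:Z ->
  e_kl R n k l = iter m (@adY R n) (mxpow X k).
Proof. by move=> ->; rewrite /e_kl opprB addrC subrK. Qed.

Lemma trform_lin (A B C : 'M[R]_n) a :
  trform A (a *: B + C) = a * trform A B + trform A C.
Proof. by rewrite /trform mulmxDr -scalemxAr linearD linearZ. Qed.

Lemma sum_odd_numbers m : sumn [seq (2 * k).+1 | k <- iota 0 m] = (m * m)%N.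
Proof.
elim: m => // m IHm.
by rewrite -[m.+1]addn1 iotaD map_cat sumn_cat IHm /= add0n; lia.
Qed.

Lemma e_kl_basis : basis_of fullv
  [seq e_kl R n k (j%:Z - k%:Z) | k <- iota 0 n, j <- iota 0 (2 * k).+1].
Proof.
rewrite basisEfree subvf dimvf dim_matrix size_allpairs_dep.
rewrite (eq_map (fun k => size_iota 0 (2 * k).+1)).
rewrite sum_odd_numbers leqnn !andbT.
pose s := [seq (k, j) | k <- iota 0 n, j <- iota 0 (2 * k).+1].
pose v (p : nat * nat) := iter (2 * p.1 - p.2) (@adY R n) (mxpow X p.1).
rewrite (_ : flatten _ = map v s); last first.
  rewrite /s map_allpairs; apply/eq_in_allpairs_dep => k _ j.
  rewrite mem_iota => /andP[_ j2k]; rewrite /v /=; apply: e_klE; lia.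
have s_mem p : p \in s -> (p.1 < n)%N && (p.2 <= 2 * p.1)%N.
  case/allpairsPdep => k [j] [].
  by rewrite !mem_iota => ? ? -> /=; lia.
(* The index $j$ stands for $l=j-k$, so [v] is $e_{kl}$ and the functional is the pairing with
   $e_{k,-l}$, whose exponent is $j$. *)
apply: (@free_map_dual _ _ _ s v
  (fun p A => trform (iter p.2 (@adY R n) (mxpow X p.1)) A)).
- by move=> *; apply: trform_lin.
- rewrite /s allpairs_uniq_dep ?iota_uniq // => [k _|[? ?] [? ?] _ _ /= [-> ->]//].
  exact: iota_uniq.
- move=> [k j] [k' j'] /s_mem /= /andP[kn j2k] /s_mem /= /andP[kn' j2k'] ne.
  apply: trform_adY_pow_eq0 => // -[ek ej].
  rewrite /= in ek ej.
  by case/negP: ne; apply/eqP; congr (_, _); lia.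
- move=> [k j] /s_mem /= /andP[kn j2k]; apply: trform_adY_pow_neq0 => //=; lia.
Qed.

Lemma trform_e_kl k k' (l l' : int) : (k < n)%N -> (k' < n)%N ->
  - (k%:Z) <= l <= k%:Z -> - (k'%:Z) <= l' <= k'%:Z ->
  ~ (k = k' /\ l + l' = 0) ->
  trform (e_kl R n k l) (e_kl R n k' l') = 0.
Proof.
move=> kn kn' lk lk' ne.
have [m em] : {m : nat | l = k%:Z - m%:Z} by exists `|k%:Z - l|%N; lia.
have [m' em'] : {m : nat | l' = k'%:Z - m%:Z} by exists `|k'%:Z - l'|%N; lia.
rewrite (e_klE _ _ _ em) (e_klE _ _ _ em').
by apply: trform_adY_pow_eq0 => // -[ek e]; apply: ne; lia.
Qed.

(** $T_j(\alpha_i)=(i-j)(n-i+j)$ is an entry of $X$, so the product is the entry of $X^l$ in column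
    $i=c+1$, with factors in reverse order. *)
Lemma Tfun_prod l c : (l <= c < n)%N ->
  \prod_(1 <= j < l.+1) Tfun n j (alpha R n c.+1) = Xweight R n l (c - l).
Proof.
move=> /andP[lc cn].
rewrite big_add1 big_mkord (reindex_inj rev_ord_inj) /Xweight /=.
apply: eq_bigr => j _; have jl := ltn_ord j.
rewrite natrM natrB; last by lia.
rewrite natrD natrB // /Tfun /alpha -!natr1 natrB // -natr1.
have E4 : 4 != 0 :> R by rewrite pnatr_eq0.
by field.
Qed.

Lemma fkl_node k l (f : {poly R}) : (l <= k < n)%N ->
  e_kl R n k l%:Z = mxpow X l *m polyH n f ->
  exists2 C : R, C != 0 & forall c : nat, (l <= c < n)%N ->
    f.[alpha R n c.+1] = C * hahn R n k l (n%:R - 1 - c%:R).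
Proof.
move=> /andP[lk kn] Hf.
have lk' : (k - l <= k)%N by lia.
have [C C0 HC] := adY_pow_upper R n k (k - l) kn lk'.
exists C => // c /andP[lc cn].
have rn : (c - l < n)%N by lia.
have := HC (Ordinal rn) (Ordinal cn).
rewrite -(e_klE k l%:Z); last by lia.
rewrite Hf mxE (bigD1 (Ordinal cn)) //= mxpowX_entry mxE /= eqxx mul1r.
rewrite big1 ?addr0 => [|j]; last first.
  by rewrite -val_eqE /= !mxE => /negbTE ->; rewrite mul0r mulr0.
have -> : (k - (k - l) = l)%N by lia.
rewrite subnK // eqxx !mul1r mulrAC [RHS]mulrC => /mulfI; apply.
by rewrite gt_eqF // Xweight_gt0 // subnK.
Qed.

(** The weights of the form are the entries of $X^l$, and $f'$ is proportional at the nodes to the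
    entries of $e_{k',-l}$, so the sum is a multiple of a trace. *)
Lemma formL_trform k k' l (f f' : {poly R}) :
  (l <= k < n)%N -> (l <= k' < n)%N ->
  e_kl R n k l%:Z = mxpow X l *m polyH n f ->
  e_kl R n k' l%:Z = mxpow X l *m polyH n f' ->
  exists2 D : R, D != 0 & formL n l f f' =
    D * trform (e_kl R n k l%:Z) (iter (k' + l) (@adY R n) (mxpow X k')).
Proof.
move=> lk lk' Hf /(fkl_node _ _ _ lk')[C C0 HC].
have /andP[lk1 kn] := lk'.
have [C' C0' HC'] := adY_pow_lower R n k' l kn lk1.
exists (C / C'); first by rewrite mulf_neq0 ?invr_eq0.
rewrite trformE exchange_big /= mulr_sumr /formL big_add1 big_geq_mkord /=.
rewrite big_mkcond /=; apply: eq_bigr => c _; case: ifP => lc; last first.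
  rewrite big1 ?mulr0 // => r _; rewrite HC'.
  by rewrite (_ : (_ == _) = false) ?mul0r ?mulr0 //; lia.
have cn := ltn_ord c.
have rn : (c - l < n)%N by lia.
rewrite Tfun_prod ?lc // (bigD1 (Ordinal rn)) //= big1 ?addr0 => [|r]; last first.
  rewrite -val_eqE /= HC' => nr.
  by rewrite (_ : (_ == _) = false) ?mul0r ?mulr0 //; lia.
rewrite HC' /= subnK // eqxx mul1r Hf mxE (bigD1 c) //=.
rewrite big1 ?addr0 => [|j]; last first.
  by rewrite -val_eqE /= !mxE => /negbTE ->; rewrite mul0r mulr0.
rewrite mxpowX_entry mxE /= subnK // !eqxx !mul1r HC ?lc //.
by field.
Qed.

Lemma fkl_basis l (f : nat -> {poly R}) : (l < n)%N ->
  (forall k, (l <= k < n)%N ->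
     e_kl R n k l%:Z = mxpow X l *m polyH n (f k)) ->
  basis_of fullv
    [seq \row_(b < n - l) (f k).[alpha R n (l + b).+1] | k <- iota l (n - l)]
  /\ (forall k k', (l <= k < n)%N -> (l <= k' < n)%N -> k <> k' ->
        formL n l (f k) (f k') = 0).
Proof.
move=> ln Hf; have orth k k' : (l <= k < n)%N -> (l <= k' < n)%N -> k <> k' ->
    formL n l (f k) (f k') = 0.
  move=> lk lk' ne.
  have [D _ ->] := formL_trform k k' l _ _ lk lk' (Hf _ lk) (Hf _ lk').
  rewrite (e_klE k l%:Z (k - l)); last by lia.
  by rewrite trform_adY_pow_eq0 ?mulr0 //; first [case; lia | lia].
have norm k : (l <= k < n)%N -> formL n l (f k) (f k) != 0.
  move=> lk; have [D D0 ->] := formL_trform k k l _ _ lk lk (Hf _ lk) (Hf _ lk).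
  rewrite (e_klE k l%:Z (k - l)); last by lia.
  by rewrite mulf_neq0 // trform_adY_pow_neq0 //; lia.
split=> //.
(* The pairing with $f_{kl}$, written on vectors of values at the nodes. *)
pose phi k (u : 'rV[R]_(n - l)) := \sum_(b < n - l) u 0 b *
  ((f k).[alpha R n (l + b).+1]
   * \prod_(1 <= j < l.+1) Tfun n j (alpha R n (l + b).+1)).
have phiE k k' : phi k (\row_b (f k').[alpha R n (l + b).+1])
    = formL n l (f k') (f k).
  rewrite /formL big_add1 /= -[X in _ = \big[_/_]_(X <= i < _) _]add0n big_addn big_mkord.
  by apply: eq_bigr => b _; rewrite mxE mulrA [(b + l)%N]addnC.
rewrite basisEfree subvf dimvf dim_matrix mul1r size_map size_iota leqnn !andbT.
have mem k : k \in iota l (n - l) -> (l <= k < n)%N.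
  by rewrite mem_iota subnKC // ltnW.
apply: (@free_map_dual _ _ _ _ _ phi).
- move=> k a u w; rewrite /phi mulr_sumr -big_split /=; apply: eq_bigr => b _.
  by rewrite !mxE mulrDl -mulrA.
- exact: iota_uniq.
- by move=> k k' /mem kn /mem kn' /eqP ne; rewrite phiE orth // => e; apply: ne.
- by move=> k /mem kn; rewrite phiE norm.
Qed.

(** * From values at the nodes to the hypergeometric formula *)

Lemma alpha_inj : injective (alpha R n).
Proof.
move=> i j; rewrite /alpha => /addIr /addrI /oppr_inj.
have E2 : 2 != 0 :> R by rewrite pnatr_eq0.
by move/(mulfI E2)/eqP; rewrite eqr_nat => /eqP.
Qed.

(** [hahn] as a polynomial in $H$, through $-x=(1-n-H)/2$. *)
Definition hahn_poly k l : {poly R} :=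
  \sum_(i < (k - l).+1) hahn_coef R n k l i *:
    \prod_(j < i) (((1 - n%:R) / 2 + j%:R)%:P - 2^-1 *: 'X).

Lemma size_hahn_poly k l : (size (hahn_poly k l) <= (k - l).+1)%N.
Proof.
apply: leq_trans (size_sum _ _ _) _; apply/bigmax_leqP => i _.
apply: leq_trans (size_scale_leq _ _) _.
apply: leq_trans (ltn_ord i); elim: (i : nat) => [|m IHm].
  by rewrite big_ord0 size_poly1.
rewrite big_ord_recr /=; apply: leq_trans (size_polyMleq _ _) _.
set q := (_ - _ : {poly R}).
have : (size q <= 2)%N.
  apply: leq_trans (size_polyD _ _) _; rewrite geq_max size_polyN.
  rewrite (leq_trans (size_polyC_leq1 _)) //.
  by rewrite (leq_trans (size_scale_leq _ _)) ?size_polyX.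
by move: IHm; move: (size _) (size q) => a b; lia.
Qed.

Lemma hahn_poly_alpha k l c :
  (hahn_poly k l).[alpha R n c.+1] = hahn R n k l (n%:R - 1 - c%:R).
Proof.
rewrite horner_sum; apply: eq_bigr => i _; rewrite hornerZ horner_prod.
congr (_ * _); apply: eq_bigr => j _.
rewrite !hornerE /alpha -natr1.
have E2 : 2 != 0 :> R by rewrite pnatr_eq0.
by field.
Qed.

Lemma fkl_hyp3F2 k l (f : {poly R}) : (l <= k < n)%N ->
  (size f <= n - l)%N ->
  e_kl R n k l%:Z = mxpow X l *m polyH n f ->
  exists c : R, c != 0 /\ polyH n f =
    c *: diagfun n (fun x : R =>
           hyp3F2 (l%:R - k%:R) (l + k + 1)%:R ((1 - n%:R - x) / 2)
                  (l + 1)%:R (l%:R + 1 - n%:R) 1 (k - l)).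
Proof.
move=> lk sf /(fkl_node _ _ _ lk)[C C0 HC]; exists C; split=> //.
(* Both sides have size at most $n-l$ and agree at $n-l$ distinct nodes. Equality then covers
   $\alpha_1,\dots,\alpha_l$ too, which $X^lf(H)$ does not detect. *)
have ef : f = C *: hahn_poly k l.
  apply/eqP; rewrite -subr_eq0; apply/eqP.
  apply: (@roots_geq_poly_eq0 _ _ [seq alpha R n c.+1 | c <- iota l (n - l)]).
  - apply/allP => _ /mapP[c + ->]; rewrite mem_iota => lc.
    rewrite rootE hornerD hornerN hornerZ hahn_poly_alpha HC ?subrr //; lia.
  - by rewrite map_inj_uniq ?iota_uniq // => i j /alpha_inj [].
  rewrite size_map size_iota; apply: leq_trans (size_polyD _ _) _.
  rewrite geq_max sf size_polyN (leq_trans (size_scale_leq _ _)) //.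
  by apply: leq_trans (size_hahn_poly k l) _; lia.
apply/matrixP => r c; rewrite !mxE mulrCA; congr (_ * _).
rewrite ef hornerZ hahn_poly_alpha -hahnE; congr (_ * hyp3F2 _ _ _ _ _ _ _).
rewrite /alpha -natr1.
have E2 : 2 != 0 :> R by rewrite pnatr_eq0.
by field.
Qed.

End Basis.

Theorem theorem8p1 (R : numFieldType) (n : nat) : (0 < n)%N ->
  (* (i) the e_{kl} form a basis of gl(n) ... *)
  ( basis_of fullv
      [seq e_kl R n k (j%:Z - k%:Z) | k <- iota 0 n, j <- iota 0 (2 * k).+1]
    (* ... and <e_{kl}, e_{k'l'}> = 0 unless k = k' and l + l' = 0 *)
    /\ (forall (k k' : nat) (l l' : int), (k < n)%N -> (k' < n)%N ->
          - (k%:Z) <= l <= k%:Z -> - (k'%:Z) <= l' <= k'%:Z ->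
          ~ (k = k' /\ l + l' = 0) ->
          trform (e_kl R n k l) (e_kl R n k' l') = 0) )
  /\
  (* f k l denotes f_{kl}, 0 <= l <= k <= n-1: the polynomial of degree < n-l
     with (ad Y)^{k-l}(X^k) = X^l f_{kl}(H) *)
  (forall f : nat -> nat -> {poly R},
     (forall k l : nat, (l <= k < n)%N ->
        (size (f k l) <= n - l)%N /\
        e_kl R n k l%:Z = mxpow (Xmx R n) l *m polyH n (f k l)) ->
     (* (ii) for fixed l, the f_{kl} (l <= k <= n-1) form an orthogonal basis
        of the functions on {alpha_{l+1}, ..., alpha_n} w.r.t. <.,.>_l *)
     (forall l : nat, (l < n)%N ->
        basis_of fullv
          [seq \row_(b < n - l) (f k l).[alpha R n (l + b).+1]
             | k <- iota l (n - l)]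
        /\ (forall k k' : nat, (l <= k < n)%N -> (l <= k' < n)%N -> k <> k' ->
              formL n l (f k l) (f k' l) = 0))
     /\
     (* (iii) f_{kl}(H) = c * 3F2(l-k, l+k+1, (1-n-H)/2; l+1, l+1-n | 1), c <> 0 *)
     (forall k l : nat, (l <= k < n)%N ->
        exists c : R, c != 0 /\
          polyH n (f k l) =
          c *: diagfun n (fun x : R =>
                 hyp3F2 (l%:R - k%:R) (l + k + 1)%:R ((1 - n%:R - x) / 2)
                        (l + 1)%:R (l%:R + 1 - n%:R) 1 (k - l)))).
Proof.
move=> _; split; first by split; [exact: e_kl_basis | exact: trform_e_kl].
move=> f Hf; split=> [l ln|k l lk].
  by apply: (fkl_basis R n l (fun k => f k l)) => // k /Hf[].
by have [sf Ef] := Hf k l lk; apply: fkl_hyp3F2.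
Qed.
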